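(* Consider $\mathcal{C}ob_{/l}$ over the ground ring $\mathbb{Z}[\frac12]$, and let $T$ be the 2-handle operator in the genus-3 presentation, i.e. $T$ acts on every morphism group by taking the disjoint union with $\frac12\Sigma_3$, where $\Sigma_3$ is the closed connected surface of genus $3$. This makes each morphism group a module over the polynomial ring $\mathbb{Z}[\frac12,T]$. Then the morphism groups of $\mathcal{C}ob_{/l}$ are generated freely over $\mathbb{Z}[\frac12,T]$ by unions of surfaces each having exactly one boundary circle and genus $0$ or $1$, together with the empty cobordism. In other words, for all $n,m\ge 0$ the $\mathbb{Z}[\frac12,T]$-module $\mathrm{Mor}(\bigcirc^n,\bigcirc^m)$ is free of rank $2^{n+m}$, with basis the $2^{n+m}$ cobordisms that are disjoint unions of $n+m$ components, one for each boundary circle, each component having that circle as its only boundary and having genus $0$ or $1$ (for $n=m=0$ the basis is the empty cobordism).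
   Context: The category $\mathcal{C}ob_{/l}$ over a commutative ground ring $R$: objects are finite (possibly empty) disjoint unions of circles $\bigcirc^n$, $n\ge 0$ ($\bigcirc^0=\emptyset$). Morphisms from $\bigcirc^n$ to $\bigcirc^m$ are formal $R$-linear combinations of compact orientable 2-dimensional cobordisms from $\bigcirc^n$ to $\bigcirc^m$ (abstract surfaces, not necessarily connected, possibly with closed components; circles and cobordisms are oriented compatibly with gluing and cobordisms are taken up to homeomorphism fixing the boundary, so a cobordism is determined by the partition of its boundary circles into connected components, the genus of each component, and the genera of its closed components), modulo the following local relations. Composition is gluing, extended bilinearly. - 4TU: if $D_1,D_2,D_3,D_4$ are four disjoint disks in the interior of a (not necessarily connected) cobordism $C$ and $C_{ij}$ denotes the cobordism obtained from $C$ by removing $D_i$ and $D_j$ and gluing in a tube (annulus, compatible with orientations) with the same boundary, then $C_{12}+C_{34}=C_{13}+C_{24}$. - S: a cobordism with a connected component that is a sphere equals $0$. - T: a connected component that is a torus may be removed and replaced by the factor $2$. The 2-handle operator $T$ on a nonempty surface adds two handles to a connected component (in $\mathcal{C}ob_{/l}$ the result does not depend on the component chosen); when $2$ is invertible it coincides with disjoint union with $\frac12\Sigma_3$, which also acts on the empty cobordism. *)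

(* Defs.v *)
From HB Require Import structures.
From mathcomp Require Import all_boot all_order all_algebra.
From mathcomp Require Import finmap multiset monalg.
From mathcomp Require Import generic_quotient ring_quotient.
From mathcomp Require Import boolp.

Set Implicit Arguments.
Unset Strict Implicit.
Unset Printing Implicit Defensive.

Import GRing.Theory.

Local Open Scope mset_scope.
Local Open Scope ring_scope.
Local Open Scope quotient_scope.

Section Quotient.
Variables (R : comNzRingType) (V : lmodType R) (G : V -> Prop).

Definition span : {pred V} := fun v => `[<
  exists s : seq (R * V),
    (forall p, p \in s -> G p.2) /\ v = \sum_(p <- s) p.1 *: p.2 >].

Lemma spanP v : reflect (exists s : seq (R * V),
    (forall p, p \in s -> G p.2) /\ v = \sum_(p <- s) p.1 *: p.2) (v \in span).
Proof. exact: asboolP. Qed.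

Lemma span_gen v : G v -> v \in span.
Proof.
move=> Gv; apply/spanP; exists [:: (1, v)]; split.
  by move=> p; rewrite inE => /eqP->.
by rewrite big_seq1 scale1r.
Qed.

Fact span_submod_closed : submod_closed span.
Proof.
split=> [|a u v /spanP[s [Gs ->]] /spanP[t [Gt ->]]].
  by apply/spanP; exists [::]; split=> //; rewrite big_nil.
apply/spanP; exists ([seq (a * p.1, p.2) | p <- s] ++ t); split=> [p|].
  by rewrite mem_cat => /orP[/mapP[q /Gs Gq ->]|/Gt].
rewrite big_cat big_map scaler_sumr; congr (_ + _).
by apply: eq_bigr => p _; rewrite scalerA.
Qed.

HB.instance Definition _ := GRing.isSubmodClosed.Build R V span
  span_submod_closed.

Local Notation I := (span : zmodClosed V).

Definition quotmod := Quotient.quot I.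

HB.instance Definition _ := GRing.Zmodule.on quotmod.

Definition quot_class (v : V) : quotmod :=
  \pi_(Quotient.quot I) v.

Lemma quot_classP u v : reflect (quot_class u = quot_class v) (u - v \in I).
Proof. by rewrite Quotient.idealrBE; apply: eqP. Qed.

Lemma quot_class_surj (x : quotmod) : exists v, quot_class v = x.
Proof. by exists (repr (x : Quotient.quot I)); rewrite /quot_class reprK. Qed.

Lemma quot_classD : {morph quot_class : u v / u + v}.
Proof. by move=> u v; rewrite /quot_class piE. Qed.

Definition quot_scale (a : R) (x : quotmod) : quotmod :=
  quot_class (a *: repr (x : Quotient.quot I)).

Lemma quot_classZ a v : quot_class (a *: v) = quot_scale a (quot_class v).
Proof.
apply/quot_classP; rewrite -scalerBr rpredZ //.
by apply/quot_classP; rewrite /quot_class reprK.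
Qed.

Fact quot_scaleA a b x : quot_scale a (quot_scale b x) = quot_scale (a * b) x.
Proof.
by case: (quot_class_surj x) => v <-; rewrite -!quot_classZ scalerA.
Qed.

Fact quot_scale1 : left_id 1 quot_scale.
Proof.
by move=> x; case: (quot_class_surj x) => v <-; rewrite -quot_classZ scale1r.
Qed.

Fact quot_scaleDr : right_distributive quot_scale +%R.
Proof.
move=> a x y; case: (quot_class_surj x) (quot_class_surj y) => u <- [v <-].
by rewrite -quot_classD -!quot_classZ scalerDr quot_classD.
Qed.

Fact quot_scaleDl x : {morph quot_scale^~ x : a b / a + b}.
Proof.
move=> a b; case: (quot_class_surj x) => v <-.
by rewrite -!quot_classZ scalerDl quot_classD.
Qed.

HB.instance Definition _ := GRing.Zmodule_isLmodule.Build R quotmod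
  quot_scaleA quot_scale1 quot_scaleDr quot_scaleDl.

Fact quot_class_is_linear : linear quot_class.
Proof. by move=> a u v; rewrite quot_classD quot_classZ. Qed.

HB.instance Definition _ := GRing.isLinear.Build R V quotmod *:%R quot_class
  quot_class_is_linear.

Variables (f : {linear V -> V}) (fI : forall v, v \in I -> f v \in I).

Definition quot_map of (forall v, v \in I -> f v \in I) : quotmod -> quotmod :=
  fun x => quot_class (f (repr (x : Quotient.quot I))).

Lemma quot_mapE v : quot_map fI (quot_class v) = quot_class (f v).
Proof.
apply/quot_classP; rewrite -raddfB; apply: fI.
by apply/quot_classP; rewrite /quot_class reprK.
Qed.

Fact quot_map_is_linear : linear (quot_map fI).
Proof.
move=> a x y; case: (quot_class_surj x) (quot_class_surj y) => u <- [v <-].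
by rewrite -linearP !quot_mapE !linearP.
Qed.

End Quotient.

(** An [R]-module [V] with an endomorphism [T] is a module over [R[X]], the
    indeterminate acting as [T].  The type [polymod T] is [V] with this
    structure. *)

Section PolynomialModule.
Variables (R : comNzRingType) (V : lmodType R) (T : {linear V -> V}).

Definition polymod of {linear V -> V} : Type := V.
Local Notation W := (polymod T).

HB.instance Definition _ := GRing.Zmodule.on W.

Definition poly_scale (p : {poly R}) (v : W) : W :=
  \sum_(i < size p) p`_i *: iter i T (v : V).

Lemma poly_scale_wide n (p : {poly R}) (v : W) : (size p <= n)%N ->
  poly_scale p v = \sum_(i < n) p`_i *: iter i T (v : V).
Proof.
move=> le_p_n; rewrite /poly_scale -!(big_mkord xpredT
  (fun i => p`_i *: iter i T (v : V))) [RHS](@big_cat_nat _ _ _ (size p)) //=.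
rewrite [X in _ = _ + X]big_nat_cond [X in _ = _ + X]big1 ?addr0 // => i.
rewrite andbT => /andP[le_p_i _].
by rewrite nth_default // scale0r.
Qed.

Fact poly_scaleDl v : {morph poly_scale^~ v : p q / p + q}.
Proof.
move=> p q; pose n := maxn (size p) (size q).
rewrite (@poly_scale_wide n (p + q)) ?size_polyD //.
rewrite (@poly_scale_wide n p) ?leq_maxl //.
rewrite (@poly_scale_wide n q) ?leq_maxr // -big_split /=.
by apply: eq_bigr => i _; rewrite coefD scalerDl.
Qed.

Lemma iter_linear i a (u v : V) :
  iter i T (a *: u + v) = a *: iter i T u + iter i T v.
Proof. by elim: i => //= i ->; rewrite linearP. Qed.

Lemma poly_scale_linear p a (u v : V) :
  poly_scale p (a *: u + v) = a *: (poly_scale p u : V) + poly_scale p v.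
Proof.
rewrite /poly_scale scaler_sumr -big_split; apply: eq_bigr => i _ /=.
by rewrite iter_linear scalerDr !scalerA mulrC.
Qed.

Fact poly_scaleDr : right_distributive poly_scale +%R.
Proof.
by move=> p u v; have := poly_scale_linear p 1 u v; rewrite !scale1r.
Qed.

Lemma poly_scale0 v : poly_scale 0 v = 0.
Proof. by rewrite /poly_scale size_poly0 big_ord0. Qed.

Lemma poly_scaleC c (v : V) : poly_scale c%:P v = c *: v.
Proof.
rewrite (@poly_scale_wide 1) ?size_polyC_leq1 //.
by rewrite big_ord1 coefC.
Qed.

Lemma poly_scaleMX p (v : V) : poly_scale (p * 'X) v = T (poly_scale p v).
Proof.
rewrite (@poly_scale_wide (size p).+1); last first.
  by rewrite (leq_trans (size_polyMleq _ _)) // size_polyX addn2.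
rewrite big_ord_recl coefMX eqxx scale0r add0r linear_sum.
by apply: eq_bigr => i _; rewrite coefMX /= linearZ.
Qed.

Fact poly_scaleA p q v : poly_scale p (poly_scale q v) = poly_scale (p * q) v.
Proof.
elim/poly_ind: p => [|p c IHp]; first by rewrite mul0r !poly_scale0.
rewrite mulrDl !poly_scaleDl mulrAC !poly_scaleMX IHp poly_scaleC.
congr (_ + _); rewrite mul_polyC /poly_scale scaler_sumr.
rewrite -/(poly_scale (c *: q) v) (@poly_scale_wide (size q)).
  by apply: eq_bigr => i _; rewrite coefZ scalerA.
exact: size_scale_leq.
Qed.

Fact poly_scale1 : left_id 1 poly_scale.
Proof. by move=> v; have := poly_scaleC 1 v; rewrite scale1r. Qed.

HB.instance Definition _ := GRing.Zmodule_isLmodule.Build {poly R} W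
  poly_scaleA poly_scale1 poly_scaleDr poly_scaleDl.

Lemma polymodC c (v : W) : c%:P *: v = c *: (v : V).
Proof. exact: poly_scaleC. Qed.

Lemma polymodX (v : W) : 'X *: v = T v.
Proof.
have := poly_scaleMX 1 v; rewrite mul1r poly_scale1.
exact: etrans.
Qed.

End PolynomialModule.

Definition is_basis (A : comNzRingType) (V : lmodType A) (I : finType)
    (b : I -> V) : Prop :=
  forall v : V, exists! c : {ffun I -> A}, v = \sum_i c i *: b i.

Definition free_of_rank (A : comNzRingType) (V : lmodType A) (r : nat) : Prop :=
  exists b : 'I_r -> V, is_basis b.

Section FreeModule.
Variables (R : comNzRingType) (K : choiceType).

Definition free_module : Type := {malg R[K]}.

HB.instance Definition _ := GRing.Lmodule.on free_module.

Definition gen (k : K) : free_module := << k >>.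

Definition free_map (f : K -> K) (x : free_module) : free_module :=
  \sum_(k <- msupp x) x@_k *: gen (f k).

Lemma free_map_wide f (d : {fset K}) x : (msupp x `<=` d)%fset ->
  free_map f x = \sum_(k <- d) x@_k *: gen (f k).
Proof.
move=> le_x_d; rewrite /free_map (big_fset_incl _ le_x_d) //= => k _.
by move/mcoeff_outdom->; rewrite scale0r.
Qed.

Lemma free_map_gen f k : free_map f (gen k) = gen (f k).
Proof.
by rewrite (free_map_wide f msuppU_le) big_seq_fset1 mcoeffUU scale1r.
Qed.

Fact free_map_is_linear f : linear (free_map f).
Proof.
move=> a x y; pose d := (msupp x `|` msupp y)%fset.
rewrite (@free_map_wide f d (a *: x + y)); last first.
  apply: fsubset_trans (msuppD_le _ _) _.
  exact/fsetSU/msuppZ_le.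
rewrite (@free_map_wide f d x) ?fsubsetUl // (@free_map_wide f d y) ?fsubsetUr //.
rewrite scaler_sumr -big_split; apply: eq_bigr => k _ /=.
by rewrite mcoeffD mcoeffZ scalerDl scalerA.
Qed.

HB.instance Definition _ f := GRing.isLinear.Build R free_module free_module
  *:%R (free_map f) (free_map_is_linear f).

End FreeModule.

Arguments gen {R K} k.

(** The boundary circles of a cobordism from [n] circles to [m] circles are
    indexed by ['I_n + 'I_m].  A connected compact oriented surface is given
    by the set of its boundary circles and its genus; it is closed when that
    set is empty. *)

Definition component (n m : nat) : Type := ({set 'I_n + 'I_m} * nat)%type.

HB.instance Definition _ n m := Choice.on (component n m).

(** A cobordism, up to homeomorphism fixing the boundary, is the multiset of
    its components: each boundary circle belongs to exactly one component,
    while closed components may be repeated. *)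

Definition is_cobordism n m (A : {mset component n m}) : bool :=
  [forall b, count (fun c : component n m => b \in c.1) A == 1%N].

Record cobordism (n m : nat) := Cobordism {
  components :> {mset component n m};
  _ : is_cobordism components }.

HB.instance Definition _ n m := [isSub for @components n m].
(* Generic instances: unification does not try to unfold them. *)
HB.instance Definition _ n m := gen_eqMixin (cobordism n m).
HB.instance Definition _ n m := gen_choiceMixin (cobordism n m).

Lemma perm_mset1D (K : choiceType) (x : K) (A : {mset K}) :
  perm_eq (x +` A)%mset (x :: A).
Proof.
by rewrite -[A in (x +` A)%mset]seq_mset_id -mset_cons perm_eq_seq_mset.
Qed.

Lemma mset1DCA (K : choiceType) (x y : K) (A : {mset K}) :
  x +` (y +` A) = y +` (x +` A).
Proof. exact: msetDCA. Qed.

Lemma mset1D_swapK (K : choiceType) (x y : K) (A : {mset K}) :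
  (x +` (y +` A)) `\ y = x +` A.
Proof. by rewrite mset1DCA msetD1K. Qed.

Lemma mset1D_swap2K (K : choiceType) (x y z : K) (A : {mset K}) :
  (x +` (y +` (z +` A))) `\ y `\ z = x +` A.
Proof.
exact: etrans (congr1 (fun B : {mset K} => B `\ z) (mset1D_swapK x y _))
  (mset1D_swapK x z A).
Qed.

Lemma mset2DK (K : choiceType) (y z : K) (A : {mset K}) :
  (y +` (z +` A)) `\ y `\ z = A.
Proof.
exact: etrans (congr1 (fun B : {mset K} => B `\ z) (msetD1K y _))
  (msetD1K z A).
Qed.

Section Operations.
Variables n m : nat.
Implicit Types (C : cobordism n m) (c d : component n m).

Lemma cobordism_count C b :
  count (fun c : component n m => b \in c.1) C = 1%N.
Proof. by case: C => A /= /forallP/(_ b)/eqP. Qed.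

(** Disjoint union with the closed connected surface of genus [g]. *)

Definition closed_component (g : nat) : component n m := (set0, g).

Fact add_closed_subproof g C : is_cobordism (closed_component g +` C)%mset.
Proof.
apply/forallP => b; rewrite (permP (perm_mset1D _ _)) /= in_set0 add0n.
by rewrite cobordism_count.
Qed.

Definition add_closed g C : cobordism n m := Cobordism (add_closed_subproof g C).

(** [comp C i] is the [i]-th component of [C], for some fixed numbering of the
    components of [C]; repeated components have distinct numbers. *)

Definition comp C (i : 'I_(size C)) : component n m := tnth (in_tuple C) i.

Lemma comp2_split C (i j : 'I_(size C)) : i != j ->
  exists A : {mset component n m},
    (C : {mset _}) = (comp i +` (comp j +` A))%mset.
Proof.
move=> neq_ij.
have pij : perm_eq (enum 'I_(size C)) (i :: j :: rem j (rem i (enum 'I_(size C)))).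
  apply: perm_trans (perm_to_rem (mem_enum _ i)) _.
  rewrite perm_cons perm_to_rem // mem_rem_uniq ?enum_uniq //.
  by rewrite inE /= eq_sym neq_ij mem_enum.
have eqC : (C : seq _) = map (@comp C) (enum 'I_(size C)).
  by rewrite -[LHS](map_tnth_enum (in_tuple C)).
exists (seq_mset (map (@comp C) (rem j (rem i (enum 'I_(size C)))))).
rewrite -!mset_cons -[LHS]seq_mset_id; apply/eq_seq_msetP.
by rewrite {1}eqC (perm_map _ pij).
Qed.

Definition add_handle c : component n m := (c.1, c.2.+1).

Definition connect_sum c d : component n m := (c.1 :|: d.1, (c.2 + d.2)%N).

(** The components after gluing a tube between a disk on component [i] and a
    disk on component [j]. *)

Definition tube_components C (i j : 'I_(size C)) : {mset component n m} :=
  (if i == j then add_handle (comp i) +` (C `\ comp i)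
   else connect_sum (comp i) (comp j) +` (C `\ comp i `\ comp j))%mset.

Fact tube_subproof C (i j : 'I_(size C)) : is_cobordism (tube_components i j).
Proof.
apply/forallP => b; rewrite /tube_components.
have := cobordism_count C b; case: (eqVneq i j) => [_|neq_ij].
  have Ci : comp i \in (C : {mset _}) by apply: mem_tnth.
  rewrite -{1}[X in count _ (enum_mset X)](msetB1K Ci).
  by rewrite !(permP (perm_mset1D _ _)) /= => ->.
have [A ->] := comp2_split neq_ij; rewrite !msetD1K.
rewrite !(permP (perm_mset1D _ _)) /= (permP (perm_mset1D _ _)) /= in_setU.
by case: (b \in (comp i).1); case: (b \in (comp j).1);
  rewrite /= ?add0n ?add1n => // ->.
Qed.

Definition tube C (i j : 'I_(size C)) : cobordism n m :=
  Cobordism (tube_subproof i j).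

(** The cobordism with one component per boundary circle [b], which has [b] as
    its only boundary and genus [e b] (0 or 1). *)

Definition cups_components (e : {ffun 'I_n + 'I_m -> bool}) :
    {mset component n m} :=
  seq_mset [seq ([set b], nat_of_bool (e b)) | b <- enum {: 'I_n + 'I_m}].

Fact cups_subproof e : is_cobordism (cups_components e).
Proof.
apply/forallP => b; rewrite (permP (perm_eq_seq_mset _)) count_map.
rewrite (eq_count (a2 := pred1 b)) => [|b' /=]; last by rewrite inE eq_sym.
by rewrite count_uniq_mem ?enum_uniq // mem_enum.
Qed.

Definition cups e : cobordism n m := Cobordism (cups_subproof e).

End Operations.

Section Morphisms.
Variables (R : comNzRingType) (n m : nat).

(** In [rel_4TU] the disk [D_k] lies on the component numbered [Dk]; several
    disks may lie on the same component. *)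

Inductive local_relation : free_module R (cobordism n m) -> Prop :=
| rel_4TU (C : cobordism n m) (D1 D2 D3 D4 : 'I_(size C)) :
    local_relation (gen (tube D1 D2) + gen (tube D3 D4)
                    - (gen (tube D1 D3) + gen (tube D2 D4)))
| rel_S (C : cobordism n m) : local_relation (gen (add_closed 0 C))
| rel_T (C : cobordism n m) :
    local_relation (gen (add_closed 1 C) - 2 *: gen C).

Definition Mor := quotmod local_relation.

HB.instance Definition _ := GRing.Lmodule.on Mor.

Definition mor_class (C : cobordism n m) : Mor :=
  quot_class local_relation (gen C).

Lemma comp_add_closed g (C : cobordism n m) :
  exists s : 'I_(size C) -> 'I_(size (add_closed g C)),
    injective s /\ forall i, comp (s i) = comp i.
Proof.
have pC : perm_eq (closed_component n m g :: C) (add_closed g C).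
  by rewrite perm_sym perm_mset1D.
have [Is pIs eqC] := perm_iotaP (closed_component n m g) pC.
have szIs : size Is = (size C).+1 by have := congr1 size eqC; rewrite size_map => <-.
have ltIs (i : 'I_(size C)) : (nth 0%N Is i.+1 < size (add_closed g C))%N.
  have : nth 0%N Is i.+1 \in Is by rewrite mem_nth // szIs ltnS.
  by rewrite (perm_mem pIs) mem_iota.
exists (fun i => Ordinal (ltIs i)); split=> [i j [] /eqP|i].
  rewrite nth_uniq ?szIs ?ltnS ?(perm_uniq pIs) ?iota_uniq //.
  by rewrite eqSS => /eqP/val_inj.
rewrite /comp !(tnth_nth (closed_component n m g)) /=.
have := congr1 (fun s => nth (closed_component n m g) s i.+1) eqC.
by rewrite /= (nth_map 0%N) ?szIs ?ltnS // => ->.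
Qed.

Lemma tube_add_closed g (C : cobordism n m) (s : 'I_(size C) -> _) :
    injective s -> (forall i, @comp _ _ (add_closed g C) (s i) = comp i) ->
  forall i j, tube (s i) (s j) = add_closed g (tube i j).
Proof.
move=> inj_s comp_s i j; apply/val_inj; rewrite /= /tube_components.
rewrite (inj_eq inj_s) !comp_s.
have -> : components (add_closed g C) = closed_component n m g +` C by [].
case: (eqVneq i j) => [_|neq_ij].
  have Ci : comp i \in (C : {mset _}) by apply: mem_tnth.
  have [A ->] : exists A, (C : {mset _}) = comp i +` A.
    by exists (C `\ comp i); rewrite msetB1K.
  by rewrite mset1D_swapK msetD1K mset1DCA.
have [A ->] := comp2_split neq_ij.
by rewrite mset1D_swap2K mset2DK mset1DCA.
Qed.

Lemma add_closedC g h (C : cobordism n m) :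
  add_closed g (add_closed h C) = add_closed h (add_closed g C).
Proof. by apply/val_inj; rewrite /= mset1DCA. Qed.

Lemma local_relation_add_closed g v : local_relation v ->
  local_relation (free_map (add_closed g) v).
Proof.
case=> [C D1 D2 D3 D4|C|C].
- have [s [inj_s comp_s]] := comp_add_closed g C.
  have tubeE i j := esym (tube_add_closed inj_s comp_s i j).
  rewrite linearB 2!linearD /= 4!free_map_gen 4!tubeE.
  exact: rel_4TU.
- by rewrite free_map_gen add_closedC; apply: rel_S.
- by rewrite linearB linearZ /= 2!free_map_gen add_closedC; apply: rel_T.
Qed.

Fact add_closed_relation g v : v \in span local_relation ->
  free_map (add_closed g) v \in span local_relation.
Proof.
move=> /spanP[s [Gs ->]]; rewrite linear_sum big_seq rpred_sum // => p /Gs Gp.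
rewrite linearZ rpredZ //; apply: span_gen.
exact: local_relation_add_closed.
Qed.

Definition mor_add_closed (g : nat) : Mor -> Mor :=
  quot_map (@add_closed_relation g).

Lemma mor_add_closedE g C :
  mor_add_closed g (mor_class C) = mor_class (add_closed g C).
Proof. by rewrite /mor_add_closed quot_mapE /= free_map_gen. Qed.

HB.instance Definition _ g := GRing.isLinear.Build R Mor Mor *:%R
  (mor_add_closed g) (quot_map_is_linear (@add_closed_relation g)).

End Morphisms.

Definition dyadic : {pred rat} := fun x =>
  `[< exists (a : int) (k : nat), x = a%:~R / 2 ^+ k >].

Fact dyadic_subring_closed : subring_closed dyadic.
Proof.
have p2 k : 2 ^+ k != 0 :> rat by rewrite expf_neq0.
split=> [|x y /asboolP[a [k ->]] /asboolP[b [l ->]]|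
          x y /asboolP[a [k ->]] /asboolP[b [l ->]]]; apply/asboolP.
- by exists 1, 0%N; rewrite expr0 divr1.
- exists (a * 2 ^+ l - b * 2 ^+ k), (k + l)%N.
  rewrite rmorphB !rmorphM !rmorphXn /= exprD.
  by rewrite -[in LHS]mulNr addf_div // mulNr.
- by exists (a * b), (k + l)%N; rewrite rmorphM exprD mulf_div.
Qed.

HB.instance Definition _ := GRing.isSubringClosed.Build rat dyadic
  dyadic_subring_closed.

Record Zhalf := MkZhalf { Zhalf_val :> rat; _ : Zhalf_val \in dyadic }.

HB.instance Definition _ := [isSub for Zhalf_val].
HB.instance Definition _ := [Choice of Zhalf by <:].
HB.instance Definition _ := [SubChoice_isSubComNzRing of Zhalf by <:].

Fact half_subproof : 1 / 2 \in dyadic.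
Proof. by apply/asboolP; exists 1, 1%N; rewrite expr1. Qed.

Definition one_half : Zhalf := MkZhalf half_subproof.

Lemma mul2_one_half : 2 * one_half = 1.
Proof. exact: val_inj. Qed.

Section TwoHandle.
Variables n m : nat.

Definition two_handle (x : Mor Zhalf n m) : Mor Zhalf n m :=
  one_half *: mor_add_closed 3 x.

Fact two_handle_is_linear : linear two_handle.
Proof.
by move=> a x y; rewrite /two_handle linearP scalerDr !scalerA mulrC.
Qed.

HB.instance Definition _ := GRing.isLinear.Build Zhalf
  (Mor Zhalf n m) (Mor Zhalf n m) *:%R two_handle two_handle_is_linear.

Definition MorT := polymod two_handle.

HB.instance Definition _ := GRing.Lmodule.on MorT.

Lemma MorT_scaleX (x : MorT) : 'X *: x = one_half *: mor_add_closed 3 x.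
Proof. exact: polymodX. Qed.

End TwoHandle.

(* Main.v *)
Require Import Defs.
From HB Require Import structures.
From mathcomp Require Import all_boot all_order all_algebra.
From mathcomp Require Import finmap multiset monalg.
From mathcomp Require Import generic_quotient ring_quotient.
From mathcomp Require Import ring lra zify.
(* Defs.comp must not be hidden by ssrfun.comp. *)
Import Defs.

(** Applying 4TU to C with an extra torus that carries two of the disks gives
    neck cutting: twice a connected sum c # d is the sum of the two surfaces
    c, d with a handle added to c or to d.  (First, the same relation on two
    extra tori shows that a closed genus 2 component kills a cobordism.)
    Cutting a neck towards a genus 2 component shows that two handles act
    as T, on any component.  So every boundary circle can be split off, and the
    genus reduced to 0 or 1.

    Linear independence comes from evaluations of the corresponding TQFT, whose
    Frobenius algebra is generated by a handle h with h^2 = T.  Setting T = s^2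
    diagonalises it: a sign vector sigma on the boundary circles is fixed, and
    the component (B, g) gets the sum of (tau s)^(g-1) over the signs tau to
    which sigma restricts on B; the factor (tau s)^|B| of the TQFT is dropped,
    as its product over all components depends only on sigma.  On the cups
    these evaluations are, up to nonzero factors, characters of the group of
    sign vectors; orthogonality and the variation of s then separate polynomial
    coefficients. *)

Set Implicit Arguments.
Unset Strict Implicit.
Unset Printing Implicit Defensive.

Import GRing.Theory Num.Theory.
Local Open Scope mset_scope.
Local Open Scope ring_scope.

(** * Multisets of components and the result of gluing a tube *)

Lemma mset_split (K : choiceType) (x : K) (B : {mset K}) :
  x \in (B : seq _) -> exists B', B = x +` B'.
Proof. by move=> Bx; exists (B `\ x); rewrite msetB1K. Qed.

Lemma mset1D_rot (K : choiceType) (x y z : K) (A : {mset K}) :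
  x +` (y +` (z +` A)) = y +` (z +` (x +` A)).
Proof. by rewrite mset1DCA; congr (_ `+` _); rewrite mset1DCA. Qed.

Lemma mset1D_rev (K : choiceType) (x y z : K) (A : {mset K}) :
  x +` (y +` (z +` A)) = z +` (x +` (y +` A)).
Proof. by rewrite [RHS]mset1D_rot. Qed.

(** Naming the remaining components [A] replaces the multiset differences in [tube_components] by
    plain sums. *)
Lemma tube_handle n m (C : cobordism n m) (i : 'I_(size C)) c
    (A : {mset component n m}) :
  comp i = c -> components C = c +` A ->
  components (tube i i) = add_handle c +` A.
Proof.
move=> ci CE; rewrite /= /tube_components eqxx ci CE msetD1K.
exact: erefl.
Qed.

Lemma tube_connect_sum n m (C : cobordism n m) (i j : 'I_(size C)) c d
    (A : {mset component n m}) :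
  i != j -> comp i = c -> comp j = d -> components C = c +` (d +` A) ->
  components (tube i j) = connect_sum c d +` A.
Proof.
move=> neq_ij ci cj CE.
rewrite /= /tube_components (negPf neq_ij) ci cj CE mset2DK.
exact: erefl.
Qed.

(** Turns a list of the components into numbers on which disks can be placed. Injectivity keeps
    equal components, such as two tori, apart. *)
Lemma comp_index n m (C : cobordism n m) (s : seq (component n m)) :
    perm_eq s C ->
  exists f : 'I_(size s) -> 'I_(size C),
    injective f /\ forall i, comp (f i) = tnth (in_tuple s) i.
Proof.
move=> pC; pose x0 : component n m := (set0, 0%N).
have [Is pIs sE] := perm_iotaP x0 pC.
have szIs : size Is = size s by rewrite [in RHS]sE size_map.
have ltIs (i : 'I_(size s)) : (nth 0%N Is i < size C)%N.
  have : nth 0%N Is i \in Is by rewrite mem_nth // szIs.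
  by rewrite (perm_mem pIs) mem_iota.
exists (fun i => Ordinal (ltIs i)); split=> [i j [] /eqP|i].
  by rewrite nth_uniq ?szIs ?(perm_uniq pIs) ?iota_uniq // => /eqP/val_inj.
rewrite /comp !(tnth_nth x0) /=.
have := congr1 (fun r => nth x0 r i) sE.
by rewrite (nth_map 0%N) ?szIs.
Qed.

Lemma quot_class0 (R : comNzRingType) (V : lmodType R) (G : V -> Prop) :
  quot_class G 0 = 0.
Proof. exact: (linear0 (quot_class G)). Qed.

Lemma half_double (V : lmodType Zhalf) (x y : V) :
  2 *: x = y -> x = one_half *: y.
Proof. by move=> <-; rewrite scalerA mulrC mul2_one_half scale1r. Qed.

Lemma double_eq0 (V : lmodType Zhalf) (x : V) :
  2 *: x + 2 *: x = x + x -> x = 0.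
Proof.
rewrite scaler_nat mulr2n => /(canRL (addrK (x + x))); rewrite subrr.
rewrite -mulr2n -scaler_nat => /half_double; rewrite scaler0 => x0.
exact: x0.
Qed.

(** * Genus 2, neck cutting and the 2-handle operator *)

Section Relations.
Variables n m : nat.
Implicit Types (C D : cobordism n m) (c d : component n m)
  (A : {mset component n m}).
Local Notation cl := (mor_class Zhalf).

Lemma mor_4TU C (D1 D2 D3 D4 : 'I_(size C)) :
  cl (tube D1 D2) + cl (tube D3 D4) = cl (tube D1 D3) + cl (tube D2 D4).
Proof.
rewrite /mor_class -!quot_classD; apply/quot_classP/span_gen.
exact: rel_4TU.
Qed.

Lemma mor_sphere C : cl (add_closed 0 C) = 0.
Proof.
rewrite -(quot_class0 (@local_relation Zhalf n m)); apply/quot_classP.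
by rewrite subr0; apply/span_gen/rel_S.
Qed.

Lemma mor_torus C : cl (add_closed 1 C) = 2 *: cl C.
Proof.
rewrite /mor_class -linearZ /=; apply/quot_classP/span_gen; exact: rel_T.
Qed.

Lemma add_closedE g C :
  components (add_closed g C) = closed_component n m g +` C.
Proof. by []. Qed.

Lemma perm_mset2 c d A : perm_eq [:: c, d & A] (c +` (d +` A)).
Proof.
rewrite perm_sym; apply: perm_trans (perm_mset1D _ _) _.
by rewrite perm_cons perm_mset1D.
Qed.

Lemma perm_mset3 c d e A : perm_eq [:: c, d, e & A] (c +` (d +` (e +` A))).
Proof.
rewrite perm_sym; apply: perm_trans (perm_mset1D _ _) _.
by rewrite perm_cons perm_sym perm_mset2.
Qed.

Lemma connect_sum_torus c : connect_sum c (closed_component n m 1) = add_handle c.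
Proof. by case: c => B g; rewrite /connect_sum /add_handle /= setU0 addn1. Qed.

(** Take two extra tori with two disks on each. A handle on either torus leaves a genus 2 surface
    and a torus, the latter worth 2, while a tube between the tori leaves one genus 2 surface. With
    [x] the class in question, 4TU reads [2x + 2x = x + x], and 2 is invertible. *)
Lemma mor_genus2 C : cl (add_closed 2 C) = 0.
Proof.
pose t := closed_component n m 1.
pose C2 := add_closed 1 (add_closed 1 C).
have [f [f_inj fE]] := comp_index (perm_mset2 t t C : perm_eq _ C2).
pose i := f (@Ordinal (size C).+2 0 isT); pose j := f (@Ordinal (size C).+2 1 isT).
have ci : comp i = t by rewrite fE.
have cj : comp j = t by rewrite fE.
have nij : i != j by rewrite (inj_eq f_inj).
have Tii : tube i i = add_closed 2 (add_closed 1 C).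
  apply/val_inj; exact: (tube_handle ci (erefl (components C2))).
have Tjj : tube j j = add_closed 2 (add_closed 1 C).
  apply/val_inj; exact: (tube_handle cj (erefl (components C2))).
have Tij : tube i j = add_closed 2 C.
  apply/val_inj; rewrite [LHS](tube_connect_sum nij ci cj (erefl _)).
  by rewrite connect_sum_torus; exact: erefl.
have := mor_4TU i i j j; rewrite Tii Tjj Tij.
rewrite add_closedC (mor_torus (add_closed 2 C)).
exact: double_eq0.
Qed.

(** 4TU with one disk on [c], one on [d] and two on an extra torus [t]. Joining [c] and [d] leaves
    [t], which gives the factor 2; a handle on [t] gives genus 2, hence 0; joining [t] to [c] or to
    [d] adds a handle there. *)
Lemma mor_neck_cutting c d A C D D1 D2 :
    components C = c +` (d +` A) ->
    components D = connect_sum c d +` A ->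
    components D1 = add_handle c +` (d +` A) ->
    components D2 = c +` (add_handle d +` A) ->
  2 *: cl D = cl D1 + cl D2.
Proof.
move=> CE DE D1E D2E; pose t := closed_component n m 1.
have C1E : components (add_closed 1 C) = t +` (c +` (d +` A)).
  by rewrite add_closedE CE.
have := perm_mset3 t c d A; rewrite -C1E => /comp_index [f [f_inj fE]].
pose r := f (@Ordinal (size A).+3 0 isT).
pose p := f (@Ordinal (size A).+3 1 isT).
pose q := f (@Ordinal (size A).+3 2 isT).
have cr : comp r = t by rewrite fE.
have cp : comp p = c by rewrite fE.
have cq : comp q = d by rewrite fE.
have npq : p != q by rewrite (inj_eq f_inj).
have npr : p != r by rewrite (inj_eq f_inj).
have nqr : q != r by rewrite (inj_eq f_inj).
have Tpq : tube p q = add_closed 1 D.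
  apply/val_inj/(etrans (tube_connect_sum npq cp cq (A := t +` A) _)).
    exact: etrans C1E (mset1D_rot _ _ _ _).
  by rewrite [RHS](add_closedE 1 D) DE; exact: mset1DCA.
have Trr : tube r r = add_closed 2 C.
  apply/val_inj; exact: (tube_handle cr (add_closedE 1 C)).
have Tpr : tube p r = D1.
  apply/val_inj/(etrans (tube_connect_sum npr cp cr (A := d +` A) _)).
    exact: etrans C1E (mset1DCA _ _ _).
  by rewrite connect_sum_torus; exact: esym D1E.
have Tqr : tube q r = D2.
  apply/val_inj/(etrans (tube_connect_sum nqr cq cr (A := c +` A) _)).
    exact: etrans C1E (mset1D_rev _ _ _ _).
  by rewrite connect_sum_torus [RHS]D2E; exact: mset1DCA.
have := mor_4TU p q r r; rewrite Tpq Trr Tpr Tqr.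
by rewrite (mor_torus D) (mor_genus2 C) addr0.
Qed.

Lemma is_cobordism1D c A : is_cobordism (c +` A) =
  [forall b, ((b \in c.1) +
    count (fun d : component n m => b \in d.1) A == 1)%N].
Proof.
by apply/eq_forallb => b; rewrite (permP (perm_mset1D c A)).
Qed.

Lemma eq_is_cobordism c d A :
  c.1 = d.1 -> is_cobordism (c +` A) = is_cobordism (d +` A).
Proof.
move=> cd; apply: etrans (is_cobordism1D c A) _; rewrite cd.
exact: esym (is_cobordism1D d A).
Qed.

(** [D] is [C] with a closed genus 2 surface joined to [c]. Cutting that neck puts the handle either
    on the closed surface, giving genus 3 next to [C], or on [c], where the genus 2 surface remains
    and kills the term. *)
Lemma mor_two_handles c A C D :
    components C = c +` A -> components D = add_handle (add_handle c) +` A ->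
  cl D = 'X *: (cl C : MorT n m).
Proof.
move=> CE DE.
have coh : is_cobordism (add_handle c +` A).
  by rewrite (@eq_is_cobordism _ c) // -CE; case: (C).
pose H := Cobordism coh.
have c2E g : components (add_closed g C) = closed_component n m g +` (c +` A).
  by rewrite add_closedE CE.
have DE2 : components D = connect_sum (closed_component n m 2) c +` A.
  have -> : connect_sum (closed_component n m 2) c = add_handle (add_handle c).
    by rewrite /connect_sum /= set0U add2n.
  exact: DE.
have := mor_neck_cutting (c2E 2) DE2 (c2E 3) (erefl (components (add_closed 2 H))).
rewrite (mor_genus2 H) addr0 => /half_double DC.
by rewrite DC MorT_scaleX mor_add_closedE.
Qed.

End Relations.

(** * The cups span *)

Section Span.
Variables (A : comNzRingType) (V : lmodType A) (I : finType) (b : I -> V).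

Definition spanned (v : V) : Prop :=
  exists c : {ffun I -> A}, v = \sum_i c i *: b i.

Lemma spanned0 : spanned 0.
Proof.
by exists [ffun=> 0]; rewrite big1 // => i _; rewrite ffunE scale0r.
Qed.

Lemma spannedD u v : spanned u -> spanned v -> spanned (u + v).
Proof.
move=> [c ->] [d ->]; exists [ffun i => c i + d i].
by rewrite -big_split; apply: eq_bigr => i _; rewrite ffunE scalerDl.
Qed.

Lemma spannedZ a v : spanned v -> spanned (a *: v).
Proof.
move=> [c ->]; exists [ffun i => a * c i].
by rewrite scaler_sumr; apply: eq_bigr => i _; rewrite ffunE scalerA.
Qed.

Lemma spanned_gen i : spanned (b i).
Proof.
exists [ffun j => (j == i)%:R]; rewrite (bigD1 i) //= ffunE eqxx scale1r.
by rewrite big1 ?addr0 // => j /negPf ji; rewrite ffunE ji scale0r.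
Qed.

End Span.

Section Spanning.
Variables n m : nat.
Implicit Types (C D : cobordism n m) (c d : component n m)
  (A : {mset component n m}).
Local Notation cl := (mor_class Zhalf).

Lemma cobordism_comp_inj C c d b :
  c \in (C : seq _) -> d \in (C : seq _) -> b \in c.1 -> b \in d.1 -> c = d.
Proof.
move=> Cc Cd cb db; apply/eqP/contraT => neq_cd.
have := cobordism_count C b.
rewrite (permP (perm_to_rem Cc)) /= cb.
have : d \in rem c C.
  by move: Cd; rewrite (perm_mem (perm_to_rem Cc)) inE eq_sym (negPf neq_cd).
by move=> /perm_to_rem/permP->; rewrite /= db.
Qed.

Lemma cobordism_has C b : exists2 c, c \in (C : seq _) & b \in c.1.
Proof. by apply/hasP; rewrite has_count cobordism_count. Qed.

Lemma cobordism_cups C :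
    (forall c, c \in (C : seq _) -> #|c.1| = 1%N /\ (c.2 <= 1)%N) ->
  exists e, C = cups e.
Proof.
move=> C1; pose e := [ffun b => ([set b], 1%N) \in (C : seq _)]; exists e.
have CP c b : c \in (C : seq _) -> b \in c.1 -> c = ([set b], nat_of_bool (e b)).
  case: c => B g Cc /= Bb; have [/= /eqP/cards1P[b' EB]] := C1 _ Cc.
  have {b' EB} EB : B = [set b] by move: Bb; rewrite EB => /set1P->.
  rewrite {B}EB in Cc Bb *; move=> g1; congr (_, _); rewrite ffunE.
  case: g g1 Cc => [|[|//]] _ Cc; last by rewrite Cc.
  case Cc1: (_ \in _) => //.
  by have [] := cobordism_comp_inj Cc Cc1 Bb Bb.
apply/val_inj; rewrite /= -[LHS]seq_mset_id; apply/eq_seq_msetP.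
apply: uniq_perm => [||c].
(* A repeated component would cover its boundary circle twice. *)
- apply: count_mem_uniq => c; case Cc: (c \in _); last first.
    by apply/eqP; rewrite -leqn0 leqNgt -has_count has_pred1 Cc.
  have [/= /eqP/cards1P[b cE] _] := C1 _ Cc.
  apply/eqP; rewrite eqn_leq -[X in _ && X]has_count has_pred1 Cc andbT.
  rewrite -(cobordism_count C b) sub_count // => d /eqP->.
  by rewrite cE set11.
- by rewrite map_inj_uniq ?enum_uniq // => b b' [/set1_inj].
- apply/idP/mapP => [Cc|[b _ ->]].
    have [/= /eqP/cards1P[b cE] _] := C1 _ Cc.
    by exists b; rewrite ?mem_enum // (CP c b) // cE set11.
  by have [d Cd db] := cobordism_has C b; rewrite -(CP d b).
Qed.

(** The induction measure. Splitting a circle off a component with [k > 1] circles may add a handle;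
    the square pays for it, as [(k-1)^2 + 1 + 1 < k^2]. *)
Definition complexity A : nat := \sum_(c <- A) (#|c.1| ^ 2 + c.2)%N.

Lemma complexity1D c A :
  complexity (c +` A) = (#|c.1| ^ 2 + c.2 + complexity A)%N.
Proof. by rewrite /complexity (perm_big _ (perm_mset1D c A)) big_cons. Qed.

Lemma spanned_mor_class C :
  spanned (fun e => cl (cups e) : MorT n m) (cl C : MorT n m).
Proof.
have [k leCk] := ubnP (complexity C); elim: k => // k IHk in C leCk *.
(* First case: some component has at least two boundary circles. *)
have [/hasP[c Cc c2]|] := boolP (has (fun c => 1 < #|c.1|)%N C).
  have [A CE] := mset_split Cc.
  have /card_gt0P[b cb] := ltnW c2.
  (* [c] is the connected sum of [c0], which has lost the circle [b], and the disk [d0] bounded by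
     [b]. *)
  pose c0 : component n m := (c.1 :\ b, c.2).
  pose d0 : component n m := ([set b], 0%N).
  have cE : connect_sum c0 d0 = c.
    by rewrite /connect_sum /= setUC setD1K // addn0; case: (c).
  have co0 : is_cobordism (c0 +` (d0 +` A)).
    have /forallP := (valP C); rewrite /= CE => coC; apply/forallP => b'.
    have := coC b'; rewrite (permP (perm_mset1D _ _)) (permP (perm_mset1D c0 _)).
    rewrite /= (permP (perm_mset1D _ _)) /= !inE.
    by case: (eqVneq b' b) => [->|_] //=; rewrite cb.
  have co1 : is_cobordism (add_handle c0 +` (d0 +` A)).
    by rewrite (@eq_is_cobordism _ _ _ c0).
  have co2 : is_cobordism (c0 +` (add_handle d0 +` A)).
    have E : is_cobordism (add_handle d0 +` (c0 +` A)) =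
      is_cobordism (d0 +` (c0 +` A)) by apply: eq_is_cobordism.
    by rewrite (mset1DCA c0 (add_handle d0)) E (mset1DCA d0 c0).
  have CE' : components C = connect_sum c0 d0 +` A by rewrite cE.
  have := @mor_neck_cutting n m c0 d0 A (Cobordism co0) C
    (Cobordism co1) (Cobordism co2) erefl CE' erefl erefl.
  move=> /half_double ->; rewrite -polymodC.
  have szc : #|c.1| = #|c0.1|.+1 by rewrite (cardsD1 b) cb.
  move: leCk; rewrite CE complexity1D szc => leCk.
  have c0_gt0 : (0 < #|c0.1|)%N by move: c2; rewrite szc.
  apply/spannedZ/spannedD; apply: IHk; rewrite [components _]/= !complexity1D.
    by rewrite /= cards1; move: leCk c0_gt0; rewrite /=; nia.
  by rewrite /= cards1; move: leCk c0_gt0; rewrite /=; nia.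
rewrite -all_predC => /allP C_le1.
(* Second case: genus at least 2, where two handles come off as a factor ['X]. *)
have [/hasP[c Cc c2]|] := boolP (has (fun c => 1 < c.2)%N C).
  have [A CE] := mset_split Cc.
  case: c c2 => [B [|[|g]]] // _ in Cc CE *.
  have co0 : is_cobordism ((B, g) +` A).
    rewrite (@eq_is_cobordism _ _ _ (B, g.+2)) //.
    by have := valP C; rewrite /= CE.
  rewrite (@mor_two_handles n m (B, g) A (Cobordism co0) C erefl CE).
  apply: spannedZ; apply: IHk; rewrite CE complexity1D in leCk.
  by rewrite [components _]/= complexity1D; move: leCk => /=; lia.
rewrite -all_predC => /allP C_genus.
(* Third case: a closed component, which by now is a sphere or a torus. *)
have [/hasP[c Cc /eqP c0]|] := boolP (has (fun c => c.1 == set0) C).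
  have [A CE] := mset_split Cc.
  have coA : is_cobordism A.
    have /forallP := valP C; rewrite /= CE => coC; apply/forallP => b.
    by have := coC b; rewrite (permP (perm_mset1D _ _)) /= c0 inE.
  have := C_genus _ Cc; rewrite /= -leqNgt.
  case: c c0 => [B [|[|//]]] /= -> in Cc CE * => _.
    have -> : C = add_closed 0 (Cobordism coA) by apply/val_inj.
    rewrite mor_sphere; exact: spanned0.
  have -> : C = add_closed 1 (Cobordism coA) by apply/val_inj.
  rewrite mor_torus -polymodC; apply/spannedZ/IHk.
  by move: leCk; rewrite CE complexity1D /=; lia.
rewrite -all_predC => /allP C_gt0.
have [|e ->] := @cobordism_cups C; last exact: spanned_gen.
move=> c Cc; have := (C_le1 _ Cc, C_genus _ Cc, C_gt0 _ Cc).
rewrite /= -!leqNgt -cards_eq0 => -[[le1 ->]].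
by case: (#|c.1|) le1 => [|[|]].
Qed.

End Spanning.

(** * Evaluations at a sign vector and a rational number *)

(** Each [f i j] is the mean of two diagonal values, so both sums equal half the sum of the same
    four. Thus 4TU only has to be checked in the form of neck cutting. *)
Lemma four_tube (I : Type) (f : I -> I -> rat) :
    (forall i j, 2 * f i j = f i i + f j j) ->
  forall i j k l, f i j + f k l - (f i k + f j l) = 0.
Proof.
move=> f2 i j k l; have := (f2 i j, f2 k l, f2 i k, f2 j l).
by move=> [[[]]]; lra.
Qed.

Definition zhalf_rat (x : Zhalf) : rat := \val x.

HB.instance Definition _ :=
  GRing.RMorphism.copy zhalf_rat (\val : Zhalf -> rat).

Section Evaluation.
Variables (n m : nat) (sigma : {ffun 'I_n + 'I_m -> bool}) (s : rat).
Hypothesis s_neq0 : s != 0.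
Implicit Types (C D : cobordism n m) (c d : component n m)
  (A : {mset component n m}) (tau : bool).

Definition handle_value tau : rat := (-1) ^+ tau * s.

Lemma handle_value_neq0 tau : handle_value tau != 0.
Proof. by rewrite mulf_neq0 ?signr_eq0. Qed.

(** The quotient encodes the exponent genus minus 1, which is -1 in genus 0. An empty boundary
    passes the test for both signs, so a closed component receives both branches. *)
Definition branch tau c : rat :=
  (c.1 \subset [set b | sigma b == tau])%:R
  * handle_value tau ^+ c.2 / handle_value tau.

Definition weight c : rat := branch false c + branch true c.

Lemma branch_handle tau c :
  branch tau (add_handle c) = handle_value tau * branch tau c.
Proof. by rewrite /branch /= exprS; ring. Qed.

Lemma branch_connect_sum tau c d : branch tau (connect_sum c d) =
  handle_value tau * (branch tau c * branch tau d).
Proof.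
have h0 := handle_value_neq0 tau.
by rewrite /branch /= subUset -mulnb natrM exprD; field.
Qed.

(** The products of branches of opposite sign occur with the coefficient [s + (- s) = 0], so only
    the terms of equal sign survive, each twice. *)
Lemma weight_neck c d : 2 * weight (connect_sum c d) =
  weight (add_handle c) * weight d + weight c * weight (add_handle d).
Proof.
by rewrite /weight !branch_connect_sum !branch_handle /handle_value; ring.
Qed.

Definition weight_mset A : rat := \prod_(c <- A) weight c.

Lemma weight_mset1D c A : weight_mset (c +` A) = weight c * weight_mset A.
Proof. by rewrite /weight_mset (perm_big _ (perm_mset1D c A)) big_cons. Qed.

Lemma weight_mset2D c d A :
  weight_mset (c +` (d +` A)) = weight c * (weight d * weight_mset A).
Proof. by rewrite !weight_mset1D. Qed.

Lemma weight_tube C (i j : 'I_(size C)) :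
  2 * weight_mset (tube i j) =
  weight_mset (tube i i) + weight_mset (tube j j).
Proof.
have [<-|neq_ij] := eqVneq i j; first by rewrite mulr_natl mulr2n.
have [A CE] := comp2_split neq_ij.
have Eij := etrans (congr1 weight_mset (tube_connect_sum neq_ij erefl erefl CE))
  (weight_mset1D _ A).
have Eii := etrans (congr1 weight_mset (tube_handle erefl CE))
  (weight_mset2D _ _ A).
have Ejj := etrans (congr1 weight_mset
  (tube_handle erefl (etrans CE (mset1DCA _ _ _)))) (weight_mset2D _ _ A).
apply: etrans (congr1 ( *%R 2) Eij) (etrans _ (esym (congr2 +%R Eii Ejj))).
by rewrite mulrA weight_neck; ring.
Qed.

Local Notation free := (free_module Zhalf (cobordism n m)).

Definition eval (x : free) : rat :=
  \sum_(C <- msupp x) zhalf_rat x@_C * weight_mset C.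

Lemma eval_wide (d : {fset cobordism n m}) (x : free) :
  (msupp x `<=` d)%fset -> eval x = \sum_(C <- d) zhalf_rat x@_C * weight_mset C.
Proof.
move=> le_x_d; rewrite /eval (big_fset_incl _ le_x_d) //= => C _.
by move/mcoeff_outdom->; rewrite rmorph0 mul0r.
Qed.

Lemma eval_gen C : eval (gen C) = weight_mset C.
Proof.
by rewrite (eval_wide msuppU_le) big_seq_fset1 mcoeffUU rmorph1 mul1r.
Qed.

Lemma evalP a (x y : free) : eval (a *: x + y) = zhalf_rat a * eval x + eval y.
Proof.
pose d := (msupp x `|` msupp y)%fset.
rewrite (@eval_wide d (a *: x + y)); last first.
  apply: fsubset_trans (msuppD_le _ _) _.
  exact/fsetSU/msuppZ_le.
rewrite (@eval_wide d x) ?fsubsetUl // (@eval_wide d y) ?fsubsetUr //.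
rewrite mulr_sumr -big_split; apply: eq_bigr => k _ /=.
by rewrite mcoeffD mcoeffZ rmorphD rmorphM mulrDl mulrA.
Qed.

Lemma eval0 : eval 0 = 0.
Proof. by rewrite /eval msupp0 big_seq_fset0. Qed.

Lemma evalD x y : eval (x + y) = eval x + eval y.
Proof. by rewrite -[x]scale1r evalP rmorph1 mul1r scale1r. Qed.

Lemma evalZ a x : eval (a *: x) = zhalf_rat a * eval x.
Proof. by rewrite -[a *: x]addr0 evalP eval0 addr0. Qed.

Lemma evalB x y : eval (x - y) = eval x - eval y.
Proof. by rewrite addrC -scaleN1r evalP rmorphN1 mulN1r addrC. Qed.

(** The values 0, 2 and [2 * s ^+ 2] in genus 0, 1 and 3 account for S, for T and for [two_handle]
    acting as [s ^+ 2]. *)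
Lemma weight_closed g : weight (closed_component n m g) =
  s ^+ g / s + (- s) ^+ g / - s.
Proof.
by rewrite /weight /branch /handle_value /= !sub0set expr0 expr1 !mul1r mulN1r.
Qed.

Lemma eval_local_relation x : local_relation x -> eval x = 0.
Proof.
case=> [C D1 D2 D3 D4|C|C].
- rewrite evalB !evalD !eval_gen.
  exact: (four_tube (f := fun i j => weight_mset (tube i j))
    (@weight_tube C)).
- rewrite eval_gen /= weight_mset1D weight_closed !expr0.
  by rewrite invrN !mul1r subrr mul0r.
- rewrite evalB evalZ !eval_gen /= weight_mset1D weight_closed !expr1.
  by rewrite !divff ?oppr_eq0 //; apply/eqP; rewrite subr_eq0.
Qed.

Lemma eval_span x : x \in span (@local_relation Zhalf n m) -> eval x = 0.
Proof.
case/spanP=> r [rP ->]; elim: r rP => [|p r IHr] rP.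
  by rewrite big_nil eval0.
rewrite big_cons evalP eval_local_relation ?mulr0 ?add0r; last first.
  by apply: rP; rewrite mem_head.
by apply: IHr => q qr; apply: rP; rewrite inE qr orbT.
Qed.

Definition mor_eval (x : Mor Zhalf n m) : rat :=
  eval (repr (x : Quotient.quot (span (@local_relation Zhalf n m)))).

(** Independence of the chosen representative, since [eval] vanishes on the relations. *)
Lemma mor_evalE v : mor_eval (quot_class (@local_relation _ n m) v) = eval v.
Proof.
apply/eqP; rewrite -subr_eq0 -evalB; apply/eqP/eval_span.
by apply/quot_classP; rewrite /quot_class reprK.
Qed.

Lemma mor_evalP a x y :
  mor_eval (a *: x + y) = zhalf_rat a * mor_eval x + mor_eval y.
Proof.
case: (quot_class_surj x) (quot_class_surj y) => u <- [v <-].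
have <- := linearP (quot_class (@local_relation Zhalf n m)) a u v.
by rewrite !mor_evalE evalP.
Qed.

Lemma mor_eval0 : mor_eval 0 = 0.
Proof. by rewrite -(quot_class0 (@local_relation Zhalf n m)) mor_evalE eval0. Qed.

Lemma mor_evalD x y : mor_eval (x + y) = mor_eval x + mor_eval y.
Proof. by have := mor_evalP 1 x y; rewrite rmorph1 mul1r scale1r. Qed.

Lemma mor_evalZ a x : mor_eval (a *: x) = zhalf_rat a * mor_eval x.
Proof. by have := mor_evalP a x 0; rewrite mor_eval0 !addr0. Qed.

Lemma mor_eval_add_closed g x :
  mor_eval (mor_add_closed g x) =
  weight (closed_component n m g) * mor_eval x.
Proof.
case: (quot_class_surj x) => v <-.
rewrite /mor_add_closed quot_mapE !mor_evalE /= /free_map.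
rewrite (big_morph eval evalD eval0) /eval mulr_sumr.
apply: eq_bigr => C _; rewrite -/(eval _) evalZ eval_gen weight_mset1D.
by rewrite mulrCA.
Qed.

Lemma mor_eval_two_handle x : mor_eval (two_handle x) = s ^+ 2 * mor_eval x.
Proof.
rewrite /two_handle mor_evalZ mor_eval_add_closed weight_closed.
have -> : zhalf_rat one_half = 1 / 2 by [].
by field.
Qed.

Lemma mor_eval_poly (p : {poly Zhalf}) (x : MorT n m) :
  mor_eval (p *: x) = (map_poly zhalf_rat p).[s ^+ 2] * mor_eval x.
Proof.
have zhalf_rat_inj : injective zhalf_rat by exact: val_inj.
rewrite horner_coef size_map_inj_poly ?rmorph0 // mulr_suml.
rewrite [p *: x]/(poly_scale _ _) /poly_scale (big_morph _ mor_evalD mor_eval0).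
apply: eq_bigr => i _; rewrite mor_evalZ coef_map -mulrA; congr (_ * _).
elim: (nat_of_ord i) => [|k IHk]; first by rewrite expr0 mul1r.
by rewrite iterS mor_eval_two_handle IHk mulrA -exprS.
Qed.

Lemma weight1 b g : weight ([set b], g) =
  handle_value (sigma b) ^+ g / handle_value (sigma b).
Proof.
rewrite /weight /branch /= !sub1set !inE.
by case: (sigma b); rewrite /= !mul0r ?add0r ?addr0 mul1r.
Qed.

Lemma weight_cups e : weight_mset (cups e) =
  \prod_b (handle_value (sigma b) ^+ e b / handle_value (sigma b)).
Proof.
rewrite /weight_mset (perm_big _ (perm_eq_seq_mset _)) big_map big_enum /=.
by apply: eq_bigr => b _; rewrite weight1.
Qed.

Lemma mor_eval_cups (c : {ffun {ffun 'I_n + 'I_m -> bool} -> {poly Zhalf}}) :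
  mor_eval (\sum_e c e *: (mor_class Zhalf (cups e) : MorT n m)) =
  \sum_e (map_poly zhalf_rat (c e)).[s ^+ 2] *
    \prod_b (handle_value (sigma b) ^+ e b / handle_value (sigma b)).
Proof.
rewrite (big_morph _ mor_evalD mor_eval0); apply: eq_bigr => e _.
by rewrite mor_eval_poly /mor_class mor_evalE eval_gen weight_cups.
Qed.

End Evaluation.

(** * Linear independence of the cups *)

(* The products over b are, up to a factor, the characters of the group of
   sign vectors sigma. *)
Lemma handle_products_free (I : finType) (s : rat)
    (x : {ffun I -> bool} -> rat) : s != 0 ->
  (forall sigma : {ffun I -> bool}, \sum_e x e *
    \prod_b (handle_value s (sigma b) ^+ e b / handle_value s (sigma b)) = 0) ->
  forall e, x e = 0.
Proof.
move=> s0 x0 e'.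
pose h := handle_value s.
(* The factor [h (sigma b)] cancels the denominator; the sign is the character indexed by [e']. *)
pose chi (sigma : {ffun I -> bool}) b : rat := h (sigma b) * (-1) ^+ (sigma b && e' b).
have : \sum_(sigma : {ffun I -> bool}) (\prod_b chi sigma b) * (\sum_e x e *
    \prod_b (h (sigma b) ^+ e b / h (sigma b))) = 0.
  by rewrite big1 // => sigma _; rewrite x0 mulr0.
have chiE sigma e : (\prod_b chi sigma b) *
    (x e * \prod_b (h (sigma b) ^+ e b / h (sigma b))) =
    x e * \prod_b (h (sigma b) ^+ e b * (-1) ^+ (sigma b && e' b)).
  rewrite mulrCA -big_split; congr (_ * _); apply: eq_bigr => b _.
  by rewrite /chi /=; have := handle_value_neq0 s0 (sigma b); rewrite -/h => ?; field.
have sumE sigma : (\prod_b chi sigma b) *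
    (\sum_e x e * \prod_b (h (sigma b) ^+ e b / h (sigma b))) =
    \sum_e x e * \prod_b (h (sigma b) ^+ e b * (-1) ^+ (sigma b && e' b)).
  by rewrite mulr_sumr; apply: eq_bigr => e _; apply: chiE.
rewrite (eq_bigr _ (fun sigma _ => sumE sigma)) exchange_big /=.
(* The sum over all sign vectors factors into a product over [b] of sums of two terms. *)
under eq_bigr => e _ do rewrite -mulr_sumr
  -(bigA_distr_bigA (fun b tau => h tau ^+ e b * (-1) ^+ (tau && e' b))).
(* For [e = e'] every factor is 2 or [2s]; for any other [e], the two terms cancel at a circle where
   [e] and [e'] differ. *)
rewrite (bigD1 e') //= [X in _ + X]big1 ?addr0 => [|e neq_e].
  move/eqP; rewrite mulf_eq0 => /orP[/eqP//|/prodf_eq0[b _]].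
  rewrite big_bool /= /h /handle_value.
  by case: (e' b); rewrite !(expr0, expr1, mul1r, mulr1, mulN1r) ?mulrN1 ?opprK
    -?mulr2n ?pnatr_eq0 // mulrn_eq0 (negPf s0).
have [b neq_b] : exists b, e b != e' b.
  apply/existsP; apply: contraNT neq_e; rewrite negb_exists => /forallP eqe.
  by apply/eqP/ffunP => b; apply/eqP; have := eqe b; rewrite negbK.
rewrite (bigD1 b) //= big_bool /= /h /handle_value.
by case: (e b) (e' b) neq_b => [] [] //= _;
  rewrite !(expr0, expr1, mul1r, mulr1, mulN1r) ?addNr ?mul0r ?mulr0.
Qed.

(** Evaluations at [s] see a coefficient only through its value at [s ^+ 2]. Taking [s = k.+1] keeps
    [s] nonzero and gives infinitely many distinct squares. *)
Lemma poly_eq0_squares (p : {poly rat}) :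
  (forall k : nat, p.[k.+1%:R ^+ 2] = 0) -> p = 0.
Proof.
move=> p0; apply/eqP/contraT => p_neq0.
pose r := [seq (k.+1%:R ^+ 2 : rat) | k <- iota 0 (size p)].
have := @max_poly_roots _ p r p_neq0; rewrite size_map size_iota ltnn; apply.
  by apply/allP => _ /mapP[k _ ->]; apply/rootP.
rewrite map_inj_uniq ?iota_uniq // => k l /eqP.
by rewrite eqrXn2 ?ler0n // eqr_nat => /eqP[].
Qed.

(** For fixed [s = k.+1], orthogonality over all [sigma] makes the coefficients of [c] and [d] agree
    at [s ^+ 2]; then [k] varies. *)
Lemma cups_free n m (c d : {ffun {ffun 'I_n + 'I_m -> bool} -> {poly Zhalf}}) :
    \sum_e c e *: (mor_class Zhalf (cups e) : MorT n m) =
    \sum_e d e *: (mor_class Zhalf (cups e) : MorT n m) ->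
  c = d.
Proof.
move=> eq_cd; apply/ffunP => e.
have zhalf_rat_inj : injective zhalf_rat by exact: val_inj.
apply: (map_inj_poly zhalf_rat_inj (rmorph0 zhalf_rat)).
apply/eqP; rewrite -subr_eq0; apply/eqP/poly_eq0_squares => k.
have k0 : k.+1%:R != 0 :> rat by rewrite pnatr_eq0.
move: e; apply: (handle_products_free k0) => sigma.
under eq_bigr => e _ do rewrite hornerD hornerN mulrBl.
by rewrite sumrB -!(mor_eval_cups sigma k0) eq_cd subrr.
Qed.

(** * The basis and its rank *)

Lemma spanned_mor n m (x : MorT n m) :
  spanned (fun e => mor_class Zhalf (cups e) : MorT n m) x.
Proof.
case: (quot_class_surj (x : Mor Zhalf n m)) => v <-.
have -> : v = \sum_(C <- msupp v) v@_C *: gen C.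
  rewrite [LHS]monalgE; apply: eq_bigr => C _; apply/malgP => D.
  by rewrite mcoeffZ !mcoeffU mulr_natr.
rewrite linear_sum.
apply: (big_ind (@spanned _ (MorT n m) _ _)) => [|u w|C _].
- exact: spanned0.
- exact: spannedD.
- rewrite linearZ /= -polymodC; apply: spannedZ; exact: spanned_mor_class.
Qed.

(** Serves to renumber the basis of cups by an ordinal type, as [free_of_rank] asks. *)
Lemma is_basis_bij (A : comNzRingType) (V : lmodType A) (I J : finType)
    (b : I -> V) (f : J -> I) :
  bijective f -> is_basis b -> is_basis (b \o f).
Proof.
move=> [g fK gK] bP v; have [c [cE c_uniq]] := bP v.
have f_bij : bijective f by exists g.
exists [ffun j => c (f j)]; split=> [|d dE].
  rewrite cE (reindex f) /=; last exact: onW_bij.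
  by apply: eq_bigr => j _; rewrite ffunE.
apply/ffunP => j; rewrite ffunE (c_uniq [ffun i => d (g i)]) ?ffunE ?fK //.
rewrite dE (reindex f) /=; last exact: onW_bij.
by apply: eq_bigr => i _; rewrite ffunE fK.
Qed.

Theorem proposition2p3 (n m : nat) :
  @is_basis {poly Zhalf} (MorT n m) {ffun 'I_n + 'I_m -> bool}
    (fun e => mor_class Zhalf (cups e))
  /\ @free_of_rank {poly Zhalf} (MorT n m) (2 ^ (n + m)).
Proof.
have basis : @is_basis {poly Zhalf} (MorT n m) {ffun 'I_n + 'I_m -> bool}
    (fun e => mor_class Zhalf (cups e)).
  move=> v; have [c vE] := spanned_mor v.
  exists c; split=> // d; rewrite vE => /cups_free; exact.
split=> //.
have card_e : #|{ffun 'I_n + 'I_m -> bool}| = (2 ^ (n + m))%N.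
  by rewrite card_ffun card_bool card_sum !card_ord.
exists ((fun e => mor_class Zhalf (cups e)) \o
  (enum_val \o cast_ord (esym card_e))).
apply: is_basis_bij basis.
exists (cast_ord card_e \o enum_rank) => x /=.
  by rewrite enum_valK cast_ordKV.
by rewrite cast_ordK enum_rankK.
Qed.
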